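(* Let $n\ge 1$ and let $A\in\mathcal{M}_n(\mathbb{C})$. If $\pi_{\mathbb{R}}(W_{\mathbb{C}}(A))=W_{\mathbb{C}}(A)\cap\mathbb{R}$, then $W_{\mathbb{H}}(A)$ is convex.
   Context: $\mathbb{H}$ denotes the real quaternions with basis $1,i,j,k$ (with $i^2=j^2=k^2=ijk=-1$), regarded as a $4$-dimensional real vector space when speaking of convexity, and $\mathbb{R}\subset\mathbb{C}=\mathrm{span}_{\mathbb{R}}\{1,i\}\subset\mathbb{H}$. For $q\in\mathbb{H}$, $q^*$ is the quaternionic conjugate and $|q|^2=qq^*$. For $\mathbb{F}\in\{\mathbb{C},\mathbb{H}\}$, $\mathcal{M}_n(\mathbb{F})$ is the set of $n\times n$ matrices over $\mathbb{F}$, and the numerical range of $A\in\mathcal{M}_n(\mathbb{F})$ in $\mathbb{F}$ is $W_{\mathbb{F}}(A)=\{x^*Ax : x\in\mathbb{F}^n,\ |x|=1\}$, where $x$ is a column vector, $x^*$ its conjugate transpose, and $|x|^2=\sum_l |x_l|^2$. A complex matrix is also regarded as a quaternionic matrix via $\mathbb{C}\subset\mathbb{H}$. $\pi_{\mathbb{R}}$ is the projection onto the real part, so $\pi_{\mathbb{R}}(W_{\mathbb{C}}(A))=\{\mathrm{Re}(w): w\in W_{\mathbb{C}}(A)\}$. *)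

(* Defs.v *)
From HB Require Import structures.
From mathcomp Require Import all_boot all_order all_algebra.
From mathcomp Require Import ring.
From mathcomp Require Import classical_sets reals convex.
From mathcomp Require Import complex.

Set Implicit Arguments.
Unset Strict Implicit.
Unset Printing Implicit Defensive.
Import Order.TTheory GRing.Theory Num.Theory.
Local Open Scope classical_set_scope.
Local Open Scope ring_scope.
Local Open Scope complex_scope.

(* [Quat a b c d] is a + b i + c j + d k. *)
Record quat (R : Type) : Type := Quat { q1 : R; qi : R; qj : R; qk : R }.

Section QuatChoice.
Variable R : Type.
Definition prod_of_quat (q : quat R) := (q1 q, qi q, qj q, qk q).
Definition quat_of_prod (t : R * R * R * R) :=
  let: (a, b, c, d) := t in Quat a b c d.
Lemma prod_of_quatK : cancel prod_of_quat quat_of_prod.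
Proof. by case. Qed.
End QuatChoice.

HB.instance Definition _ (R : eqType) := Equality.copy (quat R)
  (can_type (@prod_of_quatK R)).
HB.instance Definition _ (R : choiceType) := Choice.copy (quat R)
  (can_type (@prod_of_quatK R)).

Section QuatRing.
Variable R : comNzRingType.
Implicit Types p q r : quat R.

Definition addq p q :=
  Quat (q1 p + q1 q) (qi p + qi q) (qj p + qj q) (qk p + qk q).
Definition oppq q := Quat (- q1 q) (- qi q) (- qj q) (- qk q).
Definition zeroq : quat R := Quat 0 0 0 0.
Definition oneq : quat R := Quat 1 0 0 0.
Definition mulq p q :=
  Quat (q1 p * q1 q - qi p * qi q - qj p * qj q - qk p * qk q)
       (q1 p * qi q + qi p * q1 q + qj p * qk q - qk p * qj q)
       (q1 p * qj q - qi p * qk q + qj p * q1 q + qk p * qi q)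
       (q1 p * qk q + qi p * qj q - qj p * qi q + qk p * q1 q).
Definition scaleq (a : R) q := Quat (a * q1 q) (a * qi q) (a * qj q) (a * qk q).

Lemma addqA : associative addq.
Proof. by move=> p q r; rewrite /addq /= !addrA. Qed.
Lemma addqC : commutative addq.
Proof. by move=> p q; congr Quat; rewrite addrC. Qed.
Lemma add0q : left_id zeroq addq.
Proof. by case=> a b c d; rewrite /addq /= !add0r. Qed.
Lemma addNq : left_inverse zeroq oppq addq.
Proof. by move=> q; rewrite /addq /= !addNr. Qed.

HB.instance Definition _ :=
  GRing.isZmodule.Build (quat R) addqA addqC add0q addNq.

Lemma mulqA : associative mulq.
Proof. by move=> p q r; congr Quat => /=; ring. Qed.
Lemma mul1q : left_id oneq mulq.
Proof. by case=> a b c d; congr Quat => /=; ring. Qed.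
Lemma mulq1 : right_id oneq mulq.
Proof. by case=> a b c d; congr Quat => /=; ring. Qed.
Lemma mulqDl : left_distributive mulq addq.
Proof. by move=> p q r; congr Quat => /=; ring. Qed.
Lemma mulqDr : right_distributive mulq addq.
Proof. by move=> p q r; congr Quat => /=; ring. Qed.
Lemma oneq_neq0 : oneq != 0.
Proof. by apply/eqP => -[/eqP]; rewrite oner_eq0. Qed.

HB.instance Definition _ := GRing.Zmodule_isNzRing.Build (quat R)
  mulqA mul1q mulq1 mulqDl mulqDr oneq_neq0.

Lemma scaleqA a b q : scaleq a (scaleq b q) = scaleq (a * b) q.
Proof. by congr Quat; rewrite /= mulrA. Qed.
Lemma scale1q : left_id 1 scaleq.
Proof. by case=> a b c d; rewrite /scaleq /= !mul1r. Qed.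
Lemma scaleqDr : right_distributive scaleq +%R.
Proof. by move=> a p q; congr Quat; rewrite /= mulrDr. Qed.
Lemma scaleqDl q : {morph scaleq^~ q : a b / a + b}.
Proof. by move=> a b; congr Quat; rewrite /= mulrDl. Qed.

HB.instance Definition _ := GRing.Zmodule_isLmodule.Build R (quat R)
  scaleqA scale1q scaleqDr scaleqDl.

Definition conjq q := Quat (q1 q) (- qi q) (- qj q) (- qk q).

Definition iq : quat R := Quat 0 1 0 0.
Definition jq : quat R := Quat 0 0 1 0.
Definition kq : quat R := Quat 0 0 0 1.

Lemma quat_relations :
  [/\ iq * iq = -1, jq * jq = -1, kq * kq = -1 & iq * jq * kq = -1].
Proof. by split; congr Quat => /=; ring. Qed.

Lemma quatE q : q = q1 q *: (1 : quat R) + qi q *: iq + qj q *: jq + qk q *: kq.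
Proof. by case: q => a b c d; congr Quat => /=; ring. Qed.

Definition quat_of_complex (z : R[i]) : quat R :=
  Quat (complex.Re z) (complex.Im z) 0 0.

End QuatRing.

Definition normq (R : rcfType) (q : quat R) : R :=
  Num.sqrt (q1 q ^+ 2 + qi q ^+ 2 + qj q ^+ 2 + qk q ^+ 2).

Lemma normq_sqr (R : rcfType) (q : quat R) :
  (normq q ^+ 2) *: (1 : quat R) = q * conjq q.
Proof.
rewrite /normq sqr_sqrtr ?addr_ge0 ?sqr_ge0 //.
by congr Quat => /=; ring.
Qed.

Lemma quat_of_complexD (R : rcfType) :
  {morph @quat_of_complex R : w z / w + z}.
Proof. by move=> [a b] [c d]; congr Quat => /=; ring. Qed.

Lemma quat_of_complexM (R : rcfType) :
  {morph @quat_of_complex R : w z / w * z}.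
Proof. by move=> [a b] [c d]; congr Quat => /=; ring. Qed.

Section NumericalRange.
Variable R : realType.

Definition vnorm (F : pzRingType) (absF : F -> R) n (x : 'cV[F]_n) : R :=
  Num.sqrt (\sum_(l < n) absF (x l 0) ^+ 2).

Definition numrange (F : pzRingType) (conjF : F -> F) (absF : F -> R) n
    (A : 'M[F]_n) : set F :=
  [set ((map_mx conjF x)^T *m A *m x) 0 0
    | x in [set x : 'cV[F]_n | vnorm absF x = 1]].

Definition numrangeC n (A : 'M[R[i]]_n) : set R[i] :=
  numrange conjc (@Normc.normc R) A.

Definition numrangeH n (A : 'M[quat R]_n) : set (quat R) :=
  numrange (@conjq R) (@normq R) A.

(* The real line and the projection onto it, both inside C. *)
Definition real_line : set R[i] := range (fun a : R => a%:C).

Definition piR (S : set R[i]) : set R[i] := [set (complex.Re w)%:C | w in S].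

End NumericalRange.

Arguments real_line : clear implicits.

(* Main.v *)
(* Put f(x) = x^* A x on H^n. Right multiplication of x by a unit quaternion
   conjugates f(x), so membership in W_H(A) depends only on the real part and on
   the length of the imaginary part.

   Let Q be a real quadratic form on H^n invariant under x -> x c for unit
   complex c. Two unit zeros x, y of Q are joined inside the cone Q = 0: choose
   c so that x c and y are orthogonal for the polar form of Q, and follow the
   segment from x c to y. Along it f is polynomial, so the intermediate value
   theorem for polynomials applies. As for the Toeplitz-Hausdorff theorem, this
   shows that the complex parts of the values of f form a convex set, also when
   x is restricted to C^n; and it shows that the lengths |Im f(x)| attained over
   a fixed real part form an interval.

   Writing x = u + v j with u, v in C^n, the real part of f(x) is a convex
   combination of real parts of points of W_C(A); by the hypothesis and convexity
   of W_C(A) it is itself in W_C(A), so the interval above starts at 0. Convexity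
   of the complex parts makes it long enough to contain |Im| of any convex
   combination of values of f. *)
Require Import Defs.
From mathcomp Require Import all_boot all_order all_algebra.
From mathcomp Require Import ring lra.
From mathcomp Require Import classical_sets reals convex interval_inference.
From mathcomp Require Import complex.
Set Implicit Arguments.
Unset Strict Implicit.
Unset Printing Implicit Defensive.
Import Order.TTheory GRing.Theory Num.Theory.
Local Open Scope classical_set_scope.
Local Open Scope ring_scope.
Local Open Scope complex_scope.

Lemma quat_eq (R : Type) (p q : quat R) :
  q1 p = q1 q -> qi p = qi q -> qj p = qj q -> qk p = qk q -> p = q.
Proof. by case: p => ? ? ? ?; case: q => ? ? ? ? /= -> -> -> ->. Qed.

(** * Quaternion identities and complex quaternions *)

Section QuatAlgebra.
Variable R : comNzRingType.
Implicit Types (p q : quat R) (a : R).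

Lemma conjqD : {morph @conjq R : p q / p + q}.
Proof. by move=> p q; apply: quat_eq => //=; ring. Qed.

Lemma conjqM p q : conjq (p * q) = conjq q * conjq p.
Proof. by apply: quat_eq => /=; ring. Qed.

Lemma conjqK : involutive (@conjq R).
Proof. by move=> q; apply: quat_eq => //=; rewrite opprK. Qed.

Lemma conjqZ a q : conjq (a *: q) = a *: conjq q.
Proof. by apply: quat_eq => //=; rewrite mulrN. Qed.

Lemma scaleqAl a p q : a *: (p * q) = (a *: p) * q.
Proof. by apply: quat_eq => /=; ring. Qed.

Lemma scaleqAr a p q : a *: (p * q) = p * (a *: q).
Proof. by apply: quat_eq => /=; ring. Qed.

Definition qsqr q := q1 q ^+ 2 + qi q ^+ 2 + qj q ^+ 2 + qk q ^+ 2.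

Definition imsqr q := qi q ^+ 2 + qj q ^+ 2 + qk q ^+ 2.

Lemma conjq_mul q : conjq q * q = qsqr q *: (1 : quat R).
Proof. by apply: quat_eq => /=; rewrite /qsqr; ring. Qed.

Lemma mul_conjq q : q * conjq q = qsqr q *: (1 : quat R).
Proof. by apply: quat_eq => /=; rewrite /qsqr; ring. Qed.

Lemma q1_conjugate g q : q1 (conjq g * q * g) = qsqr g * q1 q.
Proof. by rewrite /qsqr /=; ring. Qed.

Lemma imsqr_conjugate g q : imsqr (conjq g * q * g) = qsqr g ^+ 2 * imsqr q.
Proof. by rewrite /qsqr /imsqr /=; ring. Qed.

(** Complex scalars commute with i, so conjugating by one only scales the i-component, while it
    mixes the j and k components. *)
Lemma qi_conjugate a b q :
  qi (conjq (Quat a b 0 0) * q * Quat a b 0 0) = (a ^+ 2 + b ^+ 2) * qi q.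
Proof. by move=> /=; ring. Qed.

Definition complex_quat q := qj q = 0 /\ qk q = 0.

Lemma complex_quatD p q :
  complex_quat p -> complex_quat q -> complex_quat (p + q).
Proof. by move=> [a b] [c d]; split; rewrite /= ?a ?b ?c ?d addr0. Qed.

Lemma complex_quatZ a q : complex_quat q -> complex_quat (a *: q).
Proof. by move=> [b c]; split; rewrite /= ?b ?c mulr0. Qed.

Lemma complex_quatM p q :
  complex_quat p -> complex_quat q -> complex_quat (p * q).
Proof. by move=> [a b] [c d]; split; rewrite /= a b c d; ring. Qed.

Lemma complex_quat_conj q : complex_quat q -> complex_quat (conjq q).
Proof. by move=> [b c]; split; rewrite /= ?b ?c oppr0. Qed.

Lemma complex_quat_sum (I : Type) (r : seq I) (F : I -> quat R) :
  (forall l, complex_quat (F l)) -> complex_quat (\sum_(l <- r) F l).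
Proof.
by move=> FC; elim/big_ind: _ => [|p q|l _]; [|exact: complex_quatD|exact: FC].
Qed.

End QuatAlgebra.

(** * Unit quaternions rotating imaginary parts *)

Section Rotation.
Variable R : rcfType.
Implicit Types (p q g : quat R).

Lemma qsqr_ge0 q : 0 <= qsqr q.
Proof. by rewrite !addr_ge0 ?sqr_ge0. Qed.

Lemma imsqr_ge0 q : 0 <= imsqr q.
Proof. by rewrite !addr_ge0 ?sqr_ge0. Qed.

Lemma qsqr_eq0 q : qsqr q = 0 -> q = 0.
Proof.
move=> q0; suff [a b c d] : [/\ q1 q = 0, qi q = 0, qj q = 0 & qk q = 0].
  exact: quat_eq.
move: q0; rewrite /qsqr; split; nra.
Qed.

Definition canonq q := Quat (q1 q) (Num.sqrt (imsqr q)) 0 0.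

(* If p is the imaginary part of q and m = |p|, then p (p + m i) = (p + m i) m i;
   p + m i vanishes exactly when p = - m i, and then j does the job. *)
Lemma rotate_canon q : exists2 g, qsqr g = 1 & conjq g * q * g = canonq q.
Proof.
have := sqr_sqrtr (imsqr_ge0 q); have := sqrtr_ge0 (imsqr q).
rewrite /canonq; move: (Num.sqrt _) => m; rewrite /imsqr.
case: q => a b c d /= m0 mE.
have [bm|bm] := eqVneq (b + m) 0.
  have bE : b = - m by lra.
  have c0 : c = 0 by rewrite bE in mE; nra.
  have d0 : d = 0 by rewrite bE in mE; nra.
  exists (jq R); first by rewrite /qsqr /=; ring.
  by rewrite c0 d0 bE; apply: quat_eq => /=; ring.
have bm0 : 0 < b + m.
  rewrite lt_neqAle eq_sym bm /=; rewrite -lerBlDl sub0r.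
  have : b ^+ 2 <= m ^+ 2 by rewrite mE; nra.
  by nra.
have m_gt0 : 0 < m by nra.
(* By [mE] this is the squared norm of p + m i, so dividing by its root [t] gives a unit. *)
have t0 : 0 < 2 * m * (b + m) by rewrite !mulr_gt0.
set t := Num.sqrt (2 * m * (b + m)).
have tE : t ^+ 2 = 2 * m * (b + m) by rewrite sqr_sqrtr // ltW.
have tV : t^-1 ^+ 2 * (2 * m * (b + m)) = 1.
  by rewrite exprVn tE mulVf // gt_eqF.
exists (t^-1 *: Quat 0 (b + m) c d).
  by rewrite -tV /qsqr /=; ring: mE.
have -> : conjq (t^-1 *: Quat 0 (b + m) c d) * Quat a b c d *
    (t^-1 *: Quat 0 (b + m) c d) =
  t^-1 ^+ 2 *: (conjq (Quat 0 (b + m) c d) * Quat a b c d * Quat 0 (b + m) c d).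
  by apply: quat_eq => /=; ring.
have -> : conjq (Quat 0 (b + m) c d) * Quat a b c d * Quat 0 (b + m) c d
   = (2 * m * (b + m)) *: Quat a m 0 0.
  by apply: quat_eq => /=; ring: mE.
by rewrite scalerA tV scale1r.
Qed.

(** Both quaternions rotate to the same canonical form; compose one rotation with the inverse of the
    other. *)
Lemma rotate_imsqr p q : q1 p = q1 q -> imsqr p = imsqr q ->
  exists2 g, qsqr g = 1 & conjq g * p * g = q.
Proof.
move=> pq1 pqi; have [g g1 gE] := rotate_canon p.
have [h h1 hE] := rotate_canon q.
have hh : h * conjq h = 1 by rewrite mul_conjq h1 scale1r.
exists (g * conjq h).
  rewrite /qsqr in g1 h1 *.
  by transitivity (qsqr g * qsqr h); [rewrite /qsqr /=; ring|rewrite /qsqr g1 h1 mulr1].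
rewrite conjqM conjqK.
have -> : h * conjq g * p * (g * conjq h) = h * (conjq g * p * g) * conjq h.
  by rewrite !mulrA.
rewrite gE /canonq pq1 pqi -/(canonq q) -hE.
by rewrite !mulrA hh mul1r -mulrA hh mulr1.
Qed.

End Rotation.

(** * The sesquilinear form x^* A y on H^n *)

Section Form.
Variables (R : rcfType) (n : nat).
(** Finite functions inherit scaling by reals from [quat R]; columns over [quat R] would be scaled
    by quaternions. *)
Local Notation V := {ffun 'I_n -> quat R}.
Implicit Types (x y z : V) (g h : quat R) (A : 'M[quat R]_n) (a t : R).

Definition qform A x y : quat R :=
  \sum_m (\sum_l conjq (x l) * A l m) * y m.

Definition rscale x g : V := [ffun l => x l * g].

Definition sqnorm x : R := \sum_l qsqr (x l).

Definition complex_vec x := forall l, complex_quat (x l).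

Lemma qformDl A x y z : qform A (x + y) z = qform A x z + qform A y z.
Proof.
rewrite /qform -big_split; apply: eq_bigr => m _ /=.
rewrite -mulrDl -big_split; congr (_ * _); apply: eq_bigr => l _ /=.
by rewrite ffunE conjqD mulrDl.
Qed.

Lemma qformDr A x y z : qform A x (y + z) = qform A x y + qform A x z.
Proof.
rewrite /qform -big_split; apply: eq_bigr => m _ /=.
by rewrite ffunE mulrDr.
Qed.

Lemma qformZl A a x y : qform A (a *: x) y = a *: qform A x y.
Proof.
rewrite /qform scaler_sumr; apply: eq_bigr => m _ /=.
rewrite scaleqAl scaler_sumr; congr (_ * _); apply: eq_bigr => l _ /=.
by rewrite ffunE conjqZ scaleqAl.
Qed.

Lemma qformZr A a x y : qform A x (a *: y) = a *: qform A x y.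
Proof.
rewrite /qform scaler_sumr; apply: eq_bigr => m _ /=.
by rewrite ffunE scaleqAr.
Qed.

Lemma qform_rscale A x y g h :
  qform A (rscale x g) (rscale y h) = conjq g * qform A x y * h.
Proof.
rewrite /qform mulr_sumr mulr_suml; apply: eq_bigr => m _ /=.
rewrite ffunE [in RHS]mulrA -[in RHS]mulrA; congr (_ * _).
rewrite mulr_sumr; apply: eq_bigr => l _ /=.
by rewrite ffunE conjqM mulrA.
Qed.

Lemma rscale1 x : rscale x 1 = x.
Proof. by apply/ffunP => l; rewrite ffunE mulr1. Qed.

Lemma qform1 x : qform 1%:M x x = sqnorm x *: (1 : quat R).
Proof.
rewrite /qform /sqnorm scaler_suml; apply: eq_bigr => m _.
rewrite (bigD1 m) //= big1 ?addr0 => [|l /negPf lm]; last first.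
  by rewrite mxE lm mulr0.
by rewrite mxE eqxx mulr1 conjq_mul.
Qed.

Lemma q1_qform1 x : q1 (qform 1%:M x x) = sqnorm x.
Proof. by rewrite qform1 /= mulr1. Qed.

Lemma sqnorm_ge0 x : 0 <= sqnorm x.
Proof. by apply: sumr_ge0 => l _; apply: qsqr_ge0. Qed.

Lemma sqnorm_eq0 x : sqnorm x = 0 -> x = 0.
Proof.
move=> /eqP; rewrite psumr_eq0 => [/allP x0|l _]; last exact: qsqr_ge0.
apply/ffunP => l; rewrite ffunE; apply: qsqr_eq0; apply/eqP.
by apply: x0; rewrite mem_index_enum.
Qed.

Lemma sqnormZ a x : sqnorm (a *: x) = a ^+ 2 * sqnorm x.
Proof. by rewrite -!q1_qform1 qformZl qformZr scalerA /= expr2. Qed.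

Lemma sqnorm_rscale x g : sqnorm (rscale x g) = qsqr g * sqnorm x.
Proof. by rewrite -!q1_qform1 qform_rscale q1_conjugate. Qed.

Lemma qform_complex A x y : (forall l m, complex_quat (A l m)) ->
  complex_vec x -> complex_vec y -> complex_quat (qform A x y).
Proof.
move=> AC xC yC; apply: complex_quat_sum => m; apply: complex_quatM => //.
by apply: complex_quat_sum => l; apply: complex_quatM => //; apply: complex_quat_conj.
Qed.

(** Makes a change of phase real-linear in the phase, so that bilinearity can expand it. *)
Lemma rscaleE x a b : rscale x (Quat a b 0 0) = a *: x + b *: rscale x (iq R).
Proof.
by apply/ffunP => l; rewrite !ffunE; apply: quat_eq => /=; ring.
Qed.

(** * Joining zeros of a phase-invariant real quadratic form *)

Definition bilin (b : V -> V -> R) :=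
  (forall a x y z, b (a *: x + y) z = a * b x z + b y z) /\
  (forall a x y z, b z (a *: x + y) = a * b z x + b z y).

Lemma bilinDD (b : V -> V -> R) s t x y : bilin b ->
  b (s *: x + t *: y) (s *: x + t *: y) =
  s ^+ 2 * b x x + s * t * (b x y + b y x) + t ^+ 2 * b y y.
Proof.
move=> [bl br].
have b0l z : b 0 z = 0 by have := bl 1 0 0 z; rewrite scale1r addr0; lra.
have b0r z : b z 0 = 0 by have := br 1 0 0 z; rewrite scale1r addr0; lra.
rewrite bl -(addr0 (t *: y)) !bl !br !b0l !b0r; ring.
Qed.

Definition phase_invariant (P : V -> R) :=
  forall a b x, a ^+ 2 + b ^+ 2 = 1 -> P (rscale x (Quat a b 0 0)) = P x.

(** Covers both the quadratic and the quartic functions to which the intermediate value theorem is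
    applied. *)
Definition poly_on_lines (P : V -> R) :=
  forall x y, exists p : {poly R}, forall t, P (t *: x + (1 - t) *: y) = p.[t].

Lemma bilin_poly_on_lines b : bilin b -> poly_on_lines (fun x => b x x).
Proof.
move=> bb x y; exists (b x x *: 'X^2 + (b x y + b y x) *: ('X * (1 - 'X))
   + b y y *: (1 - 'X) ^+ 2) => t.
by rewrite bilinDD // !hornerE /=; ring.
Qed.

(* After rotating x by a phase that makes x and y orthogonal for the polar form
   of b, the whole segment from x to y lies in the cone b = 0. *)
Lemma level_ivt (b : V -> V -> R) (P : V -> R) x y :
    bilin b -> phase_invariant (fun x => b x x) ->
    poly_on_lines P -> phase_invariant P ->
    sqnorm x = 1 -> sqnorm y = 1 -> b x x = 0 -> b y y = 0 ->
    P x <= 0 -> 0 <= P y ->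
  exists z, [/\ 0 < sqnorm z, b z z = 0, P z = 0 &
    complex_vec x -> complex_vec y -> complex_vec z].
Proof.
move=> bb bphase Ppoly Pphase nx ny bx by0 Px Py.
set u := b x y + b y x; set v := b (rscale x (iq R)) y + b y (rscale x (iq R)).
have [c0 [c1 [c01 cuv]]] :
    exists c0 c1, c0 ^+ 2 + c1 ^+ 2 = 1 /\ c0 * u + c1 * v = 0.
  have [uv|uv] := eqVneq (u ^+ 2 + v ^+ 2) 0.
    exists 1, 0; split; first by ring.
    have -> : u = 0 by nra.
    by ring.
  have uv0 : 0 < u ^+ 2 + v ^+ 2 by rewrite lt_neqAle eq_sym uv addr_ge0 ?sqr_ge0.
  set s := Num.sqrt (u ^+ 2 + v ^+ 2).
  have sE : s ^+ 2 = u ^+ 2 + v ^+ 2 by rewrite sqr_sqrtr // ltW.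
  have s0 : s != 0 by rewrite sqrtr_eq0 -ltNge.
  exists (v / s), (- u / s); split; last by field.
  by rewrite !expr_div_n sqrrN -mulrDl addrC -sE divff // sqrf_eq0.
have polar a c : b (rscale x (Quat a c 0 0)) y + b y (rscale x (Quat a c 0 0))
    = a * u + c * v.
  have [bl br] := bb; rewrite rscaleE -(addr0 (c *: _)) !bl !br.
  have := bl 1 0 0 y; have := br 1 0 0 y; rewrite scale1r addr0 /u /v; lra.
(* If x c = - y, the segment passes through 0. The phase - c is equally orthogonal, and it could
   fail too only for y = 0. *)
have [d0 [d1 [d01 duv xNy]]] : exists d0 d1, [/\ d0 ^+ 2 + d1 ^+ 2 = 1,
    d0 * u + d1 * v = 0 & rscale x (Quat d0 d1 0 0) <> - y].
  have [e|/eqP ?] := eqVneq (rscale x (Quat c0 c1 0 0)) (- y); last by exists c0, c1.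
  exists (- c0), (- c1); split; [by rewrite !sqrrN|by lra|].
  have -> : rscale x (Quat (- c0) (- c1) 0 0) = - rscale x (Quat c0 c1 0 0).
    by apply/ffunP => l; rewrite !ffunE; apply: quat_eq => /=; ring.
  rewrite e opprK => yNy.
  have y0 : y = 0.
    have : 2%:R *: y = 0 by rewrite scaler_nat mulr2n {1}yNy addNr.
    by move/eqP; rewrite scaler_eq0 pnatr_eq0 => /eqP.
  move: ny; rewrite y0 -(scale0r 0) sqnormZ; lra.
set x' := rscale x (Quat d0 d1 0 0) in xNy.
have nx' : sqnorm x' = 1 by rewrite sqnorm_rscale nx /qsqr /= !expr0n /= !addr0 d01 mulr1.
have bx' : b x' x' = 0 by rewrite bphase.
have [p pE] := Ppoly x' y.
(* Substituting 1 - X puts the endpoint [x'] at parameter 0, where [poly_ivt] expects the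
   nonpositive value. *)
have pV t : (p \Po (1 - 'X)).[t] = p.[1 - t] by rewrite horner_comp !hornerE.
have [||t /andP[t0 t1] /rootP] := @Num.poly_ivt R (p \Po (1 - 'X)) 0 1.
- exact: ler01.
- rewrite !pV -!pE !(subr0, subrr, scale1r, scale0r, addr0, add0r).
  by rewrite Pphase // Px.
rewrite pV -pE; set s := 1 - t => Pz.
exists (s *: x' + (1 - s) *: y); split => //; last first.
- move=> xC yC l; rewrite !ffunE; apply: complex_quatD; apply: complex_quatZ => //.
  by apply: complex_quatM.
- by rewrite bilinDD // bx' by0 polar duv; ring.
(* If the point were 0, then s x' and (1 - s) y would have equal norms, forcing s = 1/2 and x' = -
   y. *)
rewrite lt_neqAle sqnorm_ge0 andbT eq_sym; apply/eqP => /sqnorm_eq0 /eqP.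
rewrite addr_eq0 => /eqP z0.
have := congr1 sqnorm z0; rewrite -scaleNr !sqnormZ nx' ny => st.
have s12 : s = 2^-1 by lra.
apply: xNy; move: z0; rewrite s12 (_ : 1 - 2^-1 = 2^-1 :> R); last by lra.
by rewrite -scalerN => /scalerI; apply; rewrite invr_eq0 pnatr_eq0.
Qed.

Lemma poly_on_linesD P Q : poly_on_lines P -> poly_on_lines Q ->
  poly_on_lines (fun x => P x + Q x).
Proof.
move=> hP hQ x y; have [p pE] := hP x y; have [q qE] := hQ x y.
by exists (p + q) => t; rewrite hornerD pE qE.
Qed.

Lemma poly_on_linesM P Q : poly_on_lines P -> poly_on_lines Q ->
  poly_on_lines (fun x => P x * Q x).
Proof.
move=> hP hQ x y; have [p pE] := hP x y; have [q qE] := hQ x y.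
by exists (p * q) => t; rewrite hornerM pE qE.
Qed.

Lemma poly_on_linesC a : poly_on_lines (fun=> a).
Proof. by move=> x y; exists a%:P => t; rewrite hornerC. Qed.

(** * Convexity of complex parts and intervals of imaginary lengths *)

Lemma bilin_q1 A : bilin (fun x y => q1 (qform A x y)).
Proof. by split=> *; rewrite ?(qformDl, qformDr) ?(qformZl, qformZr). Qed.

Lemma bilin_qi A : bilin (fun x y => qi (qform A x y)).
Proof. by split=> *; rewrite ?(qformDl, qformDr) ?(qformZl, qformZr). Qed.

Lemma bilin_qj A : bilin (fun x y => qj (qform A x y)).
Proof. by split=> *; rewrite ?(qformDl, qformDr) ?(qformZl, qformZr). Qed.

Lemma bilin_qk A : bilin (fun x y => qk (qform A x y)).
Proof. by split=> *; rewrite ?(qformDl, qformDr) ?(qformZl, qformZr). Qed.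

(** On the unit vectors, the zeros of its quadratic form are those whose complex part of x^* A x
    lies on the line a X + b Y + c = 0. *)
Definition pencil A a b c x y :=
  a * q1 (qform A x y) + b * qi (qform A x y) + c * q1 (qform 1%:M x y).

Lemma pencil_bilin A a b c : bilin (pencil A a b c).
Proof.
split=> *; rewrite /pencil.
  by rewrite !qformDl !qformZl /=; ring.
by rewrite !qformDr !qformZr /=; ring.
Qed.

Lemma pencil_phase A a b c : phase_invariant (fun x => pencil A a b c x x).
Proof.
move=> c0 c1 x c01; rewrite /pencil !qform_rscale qi_conjugate !q1_conjugate.
by rewrite /qsqr /= expr0n /= !addr0 c01 !mul1r.
Qed.

(** [level_ivt] yields only a nonzero vector; homogeneous equations pass to the unit vector after
    multiplication by a power of a^2. *)
Lemma normalize x : 0 < sqnorm x ->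
  exists a, [/\ a ^+ 2 * sqnorm x = 1, sqnorm (a *: x) = 1 &
    forall A, qform A (a *: x) (a *: x) = a ^+ 2 *: qform A x x].
Proof.
move=> x0; exists (Num.sqrt (sqnorm x))^-1.
have aE : (Num.sqrt (sqnorm x))^-1 ^+ 2 * sqnorm x = 1.
  by rewrite exprVn sqr_sqrtr ?ltW // mulVf // gt_eqF.
by split=> [//||A]; rewrite ?sqnormZ // qformZl qformZr scalerA expr2.
Qed.

(** The Toeplitz-Hausdorff argument; the final implication lets it run inside C^n. *)
Lemma complex_part_convex A x y s : 0 <= s <= 1 -> sqnorm x = 1 -> sqnorm y = 1 ->
  exists z, [/\ sqnorm z = 1,
    q1 (qform A z z) = s * q1 (qform A x x) + (1 - s) * q1 (qform A y y),
    qi (qform A z z) = s * qi (qform A x x) + (1 - s) * qi (qform A y y) &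
    complex_vec x -> complex_vec y -> complex_vec z].
Proof.
move=> /andP[s0 s1] nx ny.
set r1 := q1 (qform A x x); set r2 := q1 (qform A y y).
set m1 := qi (qform A x x); set m2 := qi (qform A y y).
set d := (r2 - r1) ^+ 2 + (m2 - m1) ^+ 2.
have d_ge0 : 0 <= d by rewrite addr_ge0 ?sqr_ge0.
have [d0|d_neq0] := eqVneq d 0.
  have /andP[] : ((r2 - r1) ^+ 2 == 0) && ((m2 - m1) ^+ 2 == 0).
    by rewrite -paddr_eq0 ?sqr_ge0 //; apply/eqP.
  rewrite !sqrf_eq0 !subr_eq0 => /eqP r12 /eqP m12.
  by exists x; split=> //; rewrite ?r12 ?m12 -/r1 -/m1; ring.
set r := s * r1 + (1 - s) * r2; set m := s * m1 + (1 - s) * m2.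
(* [B] vanishes on the line through the two values. [P] is the position along that line relative to
   the target: - (1 - s) d at x and s d at y. *)
pose B := pencil A (m2 - m1) (r1 - r2) ((r2 - r1) * m1 - (m2 - m1) * r1).
pose P := pencil A (r2 - r1) (m2 - m1) (- ((r2 - r1) * r + (m2 - m1) * m)).
have [||||z [z0 Bz Pz zC]] := @level_ivt B (fun x => P x x) x y
    (pencil_bilin _ _ _ _) (@pencil_phase _ _ _ _)
    (bilin_poly_on_lines (pencil_bilin _ _ _ _)) (@pencil_phase _ _ _ _) nx ny.
- by rewrite /B /pencil q1_qform1 nx -/r1 -/m1; ring.
- by rewrite /B /pencil q1_qform1 ny -/r2 -/m2; ring.
- rewrite /P /pencil q1_qform1 nx -/r1 -/m1.
  have : 0 <= (1 - s) * d by rewrite mulr_ge0 ?subr_ge0.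
  by rewrite /d /r /m; lra.
- rewrite /P /pencil q1_qform1 ny -/r2 -/m2.
  have : 0 <= s * d by rewrite mulr_ge0.
  by rewrite /d /r /m; lra.
have [a [aE nz fz]] := normalize z0.
have Bz' : a ^+ 2 * B z z = 0 by rewrite Bz mulr0.
have Pz' : a ^+ 2 * P z z = 0 by rewrite Pz mulr0.
move: Bz' Pz'; rewrite /B /P /pencil q1_qform1.
move=> Bz' Pz'; exists (a *: z); rewrite fz /=.
set p := a ^+ 2 * q1 _; set q := a ^+ 2 * qi _.
have {}Bz' : (m2 - m1) * (p - r1) = (r2 - r1) * (q - m1).
  apply/eqP; rewrite -subr_eq0; apply/eqP; rewrite -[RHS]Bz' /p /q.
  by ring: aE.
have {}Pz' : (r2 - r1) * (p - r) + (m2 - m1) * (q - m) = 0.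
  by rewrite -[RHS]Pz' /p /q; ring: aE.
(* The displacement from the target is parallel to (r2 - r1, m2 - m1) by [line] and orthogonal to it
   by [Pz'], so d times it is zero. *)
have line : (m2 - m1) * (p - r) = (r2 - r1) * (q - m) by rewrite /r /m; lra.
split => //.
- apply/eqP; rewrite -subr_eq0; apply/eqP; apply: (mulfI d_neq0).
  transitivity ((r2 - r1) * ((r2 - r1) * (p - r) + (m2 - m1) * (q - m))).
    by rewrite [RHS]mulrDr [X in _ = _ + X]mulrCA -line /d; ring.
  by rewrite Pz' !mulr0.
- apply/eqP; rewrite -subr_eq0; apply/eqP; apply: (mulfI d_neq0).
  transitivity ((m2 - m1) * ((r2 - r1) * (p - r) + (m2 - m1) * (q - m))).
    by rewrite [RHS]mulrDr [X in _ = X + _]mulrCA line /d; ring.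
  by rewrite Pz' !mulr0.
- by move=> xC yC l; rewrite ffunE; apply: complex_quatZ; apply: zC.
Qed.

Lemma imsqr_fiber A x y r m : sqnorm x = 1 -> sqnorm y = 1 ->
  q1 (qform A x x) = r -> q1 (qform A y y) = r ->
  imsqr (qform A x x) <= m <= imsqr (qform A y y) ->
  exists z, [/\ sqnorm z = 1, q1 (qform A z z) = r & imsqr (qform A z z) = m].
Proof.
move=> nx ny xr yr /andP[xm my].
(* The square on [sqnorm z] makes [P] homogeneous of degree four, so its zeros survive
   normalization. *)
pose P z := imsqr (qform A z z) + - m * sqnorm z ^+ 2.
have [||||||z [z0 Bz Pz _]] := @level_ivt (pencil A 1 0 (- r)) P x y
    (pencil_bilin _ _ _ _) (@pencil_phase _ _ _ _) _ _ nx ny.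
- apply: poly_on_linesD.
    have h f : bilin (fun x y => f (qform A x y)) ->
        poly_on_lines (fun x => f (qform A x x) ^+ 2).
      by move=> /bilin_poly_on_lines hf; apply: poly_on_linesM.
    by do 2?apply: poly_on_linesD; apply: h;
      [exact: bilin_qi|exact: bilin_qj|exact: bilin_qk].
  apply: poly_on_linesM; first exact: poly_on_linesC.
  have hn : poly_on_lines sqnorm.
    move=> u v; have [p pE] := bilin_poly_on_lines (bilin_q1 1%:M) u v.
    by exists p => t; rewrite -pE q1_qform1.
  exact: poly_on_linesM.
- move=> a b z ab; rewrite /P qform_rscale imsqr_conjugate sqnorm_rscale.
  by rewrite /qsqr /= !expr0n /= !addr0 ab expr1n !mul1r.
- by rewrite /pencil q1_qform1 nx xr; ring.
- by rewrite /pencil q1_qform1 ny yr; ring.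
- by rewrite /P nx; lra.
- by rewrite /P ny; lra.
have [a [aE nz fz]] := normalize z0.
exists (a *: z); split=> //; rewrite fz /=.
- move: Bz; rewrite /pencil q1_qform1 => Bz.
  have {}Bz : q1 (qform A z z) = r * sqnorm z by lra.
  by rewrite Bz; ring: aE.
- have {}Pz : imsqr (qform A z z) = m * sqnorm z ^+ 2 by rewrite /P in Pz; lra.
  transitivity (a ^+ 2 ^+ 2 * imsqr (qform A z z)); first by rewrite /imsqr /=; ring.
  by rewrite Pz; ring: aE.
Qed.

End Form.

(** * Numerical ranges as values of the form *)

Section NumericalRangeForm.
Variables (R : realType) (n : nat).
Local Notation V := {ffun 'I_n -> quat R}.
Local Notation "z %:H" := (quat_of_complex z) (at level 2).

Lemma sqrt_eq1 (a : R) : 0 <= a -> (Num.sqrt a = 1 <-> a = 1).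
Proof.
move=> a0; split=> [s1|->]; last exact: sqrtr1.
by rewrite -(sqr_sqrtr a0) s1 expr1n.
Qed.

Lemma numrangeHE (B : 'M[quat R]_n) q :
  numrangeH B q <-> exists2 x : V, sqnorm x = 1 & qform B x x = q.
Proof.
have norm (v : 'cV[quat R]_n) :
    vnorm (@Defs.normq R) v = Num.sqrt (sqnorm [ffun l => v l 0]).
  congr Num.sqrt; apply: eq_bigr => l _.
  by rewrite ffunE sqr_sqrtr // qsqr_ge0.
have form (v : 'cV[quat R]_n) : ((map_mx (@conjq R) v)^T *m B *m v) 0 0 =
    qform B [ffun l => v l 0] [ffun l => v l 0].
  rewrite !mxE; apply: eq_bigr => m _; rewrite !mxE ffunE; congr (_ * _).
  by apply: eq_bigr => l _; rewrite !mxE ffunE.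
split=> [[v /= nv <-]|[x nx <-]].
  exists [ffun l => v l 0]; last by rewrite form.
  by apply/sqrt_eq1; [exact: sqnorm_ge0 | rewrite -norm].
have xE : [ffun l => (\col_l x l) l 0] = x by apply/ffunP => l; rewrite ffunE mxE.
exists (\col_l x l) => /=; last by rewrite form xE.
by rewrite norm xE nx sqrtr1.
Qed.

Lemma quat_of_complex_conj (z : R[i]) : (conjc z)%:H = conjq z%:H.
Proof. by case: z => a b; apply: quat_eq; rewrite //= oppr0. Qed.

(** Reads W_C(A) off the quaternionic form on complex vectors, so that one form serves both
    ranges. *)
Lemma numrangeC_qform (A : 'M[R[i]]_n) w :
  numrangeC A w <-> exists x : V, [/\ sqnorm x = 1, complex_vec x &
    qform (map_mx (@quat_of_complex R) A) x x = w%:H].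
Proof.
have norm (v : 'cV[R[i]]_n) :
    vnorm (@Normc.normc R) v = Num.sqrt (sqnorm [ffun l => (v l 0)%:H]).
  congr Num.sqrt; apply: eq_bigr => l _.
  rewrite ffunE /qsqr /=; case: (v l 0) => a b /=.
  by rewrite sqr_sqrtr ?addr_ge0 ?sqr_ge0 // !expr0n /= !addr0.
have q0 : (0 : R[i])%:H = 0 by [].
have form (v : 'cV[R[i]]_n) : (((map_mx conjc v)^T *m A *m v) 0 0)%:H =
    qform (map_mx (@quat_of_complex R) A) [ffun l => (v l 0)%:H] [ffun l => (v l 0)%:H].
  rewrite !mxE (big_morph _ (@quat_of_complexD R) q0).
  apply: eq_bigr => m _; rewrite !mxE ffunE quat_of_complexM; congr (_ * _).
  rewrite (big_morph _ (@quat_of_complexD R) q0).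
  apply: eq_bigr => l _; rewrite !mxE ffunE quat_of_complexM; congr (_ * _).
  by rewrite quat_of_complex_conj.
split=> [[v /= nv <-]|[x [nx xC xw]]].
  exists [ffun l => (v l 0)%:H]; split; last by rewrite form.
    by apply/sqrt_eq1; [exact: sqnorm_ge0 | rewrite -norm].
  by move=> l; rewrite ffunE; split.
pose v : 'cV[R[i]]_n := \col_l (q1 (x l) +i* qi (x l)).
have xE : [ffun l => (v l 0)%:H] = x.
  by apply/ffunP => l; have [xj xk] := xC l; rewrite ffunE mxE; apply: quat_eq.
exists v; first by rewrite /= norm xE nx sqrtr1.
have := form v; rewrite xE xw.
by case: (_ 0 0) w {xw} => a b [c d] [-> ->].
Qed.

Variable A : 'M[R[i]]_n.
Hypothesis n_gt0 : (0 < n)%N.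
Hypothesis hA : piR (numrangeC A) = numrangeC A `&` real_line R.
Let B := map_mx (@quat_of_complex R) A.

Lemma complex_quat_map l m : complex_quat (B l m).
Proof. by rewrite mxE; split. Qed.

(** By [hA], the real part of a point of W_C(A) is again in W_C(A). The factor [sqnorm u] allows u =
    0. *)
Lemma real_value (u : V) : complex_vec u ->
  exists w : V, [/\ sqnorm w = 1, complex_vec w, qi (qform B w w) = 0 &
    sqnorm u * q1 (qform B w w) = q1 (qform B u u)].
Proof.
have unit (v : V) : sqnorm v = 1 -> complex_vec v ->
    exists w : V, [/\ sqnorm w = 1, complex_vec w, qi (qform B w w) = 0 &
    q1 (qform B w w) = q1 (qform B v v)].
  move=> nv vC; have [vj vk] := qform_complex complex_quat_map vC vC.
  have : piR (numrangeC A) (q1 (qform B v v))%:C.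
    exists (q1 (qform B v v) +i* qi (qform B v v)) => //.
    by apply/numrangeC_qform; exists v; split=> //; apply: quat_eq.
  rewrite hA => -[/numrangeC_qform [w [nw wC wE]] _].
  by exists w; rewrite -/B in wE; rewrite wE.
move=> uC; have := sqnorm_ge0 u; rewrite le_eqVlt => /predU1P [u0|u_gt0].
  (* For u = 0 both sides vanish; a basis vector, available since n > 0, goes through [unit] only to
     obtain some real value. *)
  have e0N : sqnorm ([ffun l => (l == Ordinal n_gt0)%:R] : V) = 1.
    rewrite /sqnorm (bigD1 (Ordinal n_gt0)) //= ffunE eqxx big1 => [|l /negPf l0].
      by rewrite /qsqr /=; ring.
    by rewrite ffunE l0 /qsqr /=; ring.
  have [|w [nw wC wi _]] := unit _ e0N.
    by move=> l; rewrite ffunE; case: eqP => _; split.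
  exists w; split=> //; rewrite (sqnorm_eq0 (esym u0)) -(scale0r 0) sqnormZ qformZl.
  by rewrite /= expr0n /= !mul0r.
have [a [aE nau fau]] := normalize u_gt0.
have [|w [nw wC wi w1]] := unit _ nau.
  by move=> l; rewrite ffunE; apply: complex_quatZ.
exists w; split=> //; rewrite w1 fau /=.
by ring: aE.
Qed.

Lemma real_value_fiber (z : V) : sqnorm z = 1 ->
  exists w : V, [/\ sqnorm w = 1, q1 (qform B w w) = q1 (qform B z z) &
    imsqr (qform B w w) = 0].
Proof.
move=> nz.
pose u : V := [ffun l => Quat (q1 (z l)) (qi (z l)) 0 0].
pose v : V := [ffun l => Quat (qj (z l)) (qk (z l)) 0 0].
have uC : complex_vec u by move=> l; rewrite ffunE; split.
have vC : complex_vec v by move=> l; rewrite ffunE; split.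
have zE : z = u + rscale v (jq R).
  by apply/ffunP => l; rewrite !ffunE; apply: quat_eq => /=; ring.
have nuv : sqnorm v = 1 - sqnorm u.
  rewrite -nz; apply/eqP; rewrite eq_sym subr_eq -big_split; apply/eqP.
  by apply: eq_bigr => l _; rewrite !ffunE /qsqr /=; ring.
(* The cross terms lie in C j and have no real part; conjugation by j preserves real parts. *)
have quv : q1 (qform B z z) = q1 (qform B u u) + q1 (qform B v v).
  rewrite zE qformDl !qformDr -{3 4}(rscale1 u) !qform_rscale.
  have [uvj uvk] := qform_complex complex_quat_map uC vC.
  have [vuj vuk] := qform_complex complex_quat_map vC uC.
  by rewrite /= uvj vuj; ring.
have [x [nx xC xi x1]] := real_value uC.
have [y [ny yC yi y1]] := real_value vC.
have s01 : 0 <= sqnorm u <= 1.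
  by have := sqnorm_ge0 v; rewrite nuv subr_ge0 sqnorm_ge0.
(* The weights are |u|^2 and |v|^2. Both endpoint values are real, so the i-component at [w]
   vanishes; the j and k components vanish because [w] is complex. *)
have [w [nw w1 wi wC]] := complex_part_convex B s01 nx ny.
have [wj wk] := qform_complex complex_quat_map (wC xC yC) (wC xC yC).
exists w; split=> //; first by rewrite w1 x1 -nuv y1 quv.
by rewrite /imsqr wi xi yi wj wk; ring.
Qed.

(** Puts the whole imaginary length into the i-component, so that [complex_part_convex] averages
    lengths. *)
Lemma canon_attained (x : V) : sqnorm x = 1 ->
  exists2 y : V, sqnorm y = 1 & qform B y y = canonq (qform B x x).
Proof.
move=> nx; have [g g1 gE] := rotate_canon (qform B x x).
exists (rscale x g); first by rewrite sqnorm_rscale g1 mul1r.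
by rewrite qform_rscale.
Qed.

End NumericalRangeForm.

(** The triangle inequality for imaginary parts, squared; it reduces to Cauchy-Schwarz. *)
Lemma sqrt_imsqr_convex (R : rcfType) (p q : quat R) (s : R) : 0 <= s <= 1 ->
  imsqr (s *: p + (1 - s) *: q) <=
  (s * Num.sqrt (imsqr p) + (1 - s) * Num.sqrt (imsqr q)) ^+ 2.
Proof.
move=> /andP[s0 s1].
set a := Num.sqrt (imsqr p); set b := Num.sqrt (imsqr q).
have aE : a ^+ 2 = imsqr p by rewrite sqr_sqrtr // imsqr_ge0.
have bE : b ^+ 2 = imsqr q by rewrite sqr_sqrtr // imsqr_ge0.
pose d := qi p * qi q + qj p * qj q + qk p * qk q.
have dab : d <= a * b.
  have ab0 : 0 <= a * b by rewrite mulr_ge0 ?sqrtr_ge0.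
  apply: le_trans (ler_norm d) _.
  rewrite -(@ler_pXn2r _ 2) ?nnegrE // -normrX ger0_norm ?sqr_ge0 // exprMn aE bE.
  rewrite -subr_ge0.
  (* Lagrange's identity in R^3. *)
  have -> : imsqr p * imsqr q - d ^+ 2 = (qi p * qj q - qj p * qi q) ^+ 2 +
      (qi p * qk q - qk p * qi q) ^+ 2 + (qj p * qk q - qk p * qj q) ^+ 2.
    by rewrite /imsqr /d; ring.
  by rewrite !addr_ge0 ?sqr_ge0.
rewrite -subr_ge0.
have -> : (s * a + (1 - s) * b) ^+ 2 - imsqr (s *: p + (1 - s) *: q) =
    2 * (s * (1 - s)) * (a * b - d).
  rewrite sqrrD !exprMn aE bE /imsqr /d /=; ring.
by rewrite !mulr_ge0 ?subr_ge0.
Qed.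

Theorem theorem3p4 (R : realType) (n : nat) (n_ge1 : (1 <= n)%N)
    (A : 'M[R[i]]_n)
    (hA : piR (numrangeC A) = numrangeC A `&` real_line R) :
  @convex_set R (quat R) (numrangeH (map_mx (@quat_of_complex R) A)).
Proof.
move=> p q s; rewrite !inE => /numrangeHE [x nx <-] /numrangeHE [y ny <-].
set B := map_mx _ A.
set target := conv _ _ _.
have [t t01 targetE] : exists2 t : R, 0 <= t <= 1 &
    target = t *: qform B x x + (1 - t) *: qform B y y.
  by exists (s%:inum); first by apply/andP; split.
have [x' nx' xE] := canon_attained A nx; have [y' ny' yE] := canon_attained A ny.
have [z [nz zr zi _]] := complex_part_convex B t01 nx' ny'.
rewrite xE yE /= in zr zi.
have zr' : q1 (qform B z z) = q1 target by rewrite targetE zr.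
have [w [nw wr wi]] := real_value_fiber n_ge1 hA nz.
(* Over the real part of [target], [w] gives imaginary length 0, and [z] gives at least that of
   [target]: its i-component alone is the mean of the two lengths. *)
have [|v [nv vr vi]] := @imsqr_fiber _ _ B w z _ (imsqr target) nw nz wr erefl.
  rewrite wi imsqr_ge0 /= targetE.
  apply: le_trans (sqrt_imsqr_convex _ _ t01) _.
  by rewrite -zi /imsqr -addrA lerDl addr_ge0 ?sqr_ge0.
(* Real part and imaginary length now agree with [target]; only a rotation remains. *)
have [g g1 gE] := rotate_imsqr (etrans vr zr') vi.
apply/numrangeHE; exists (rscale v g); first by rewrite sqnorm_rscale g1 mul1r.
by rewrite qform_rscale.
Qed.
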